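(* Given $x_0\in\mathcal{H}$ and $w_0\in\mathcal{K}$, the following conditions are equivalent: (i) $\displaystyle\inf_{y\in\mathcal{C}_V}[T(x_0+y)-w_0,T(x_0+y)-w_0]_{\mathcal{K}}>-\infty$; (ii) there exists a constant $c\geq 0$ such that $$\big|[Tx_0-w_0,Ty]_{\mathcal{K}}\big|^2\leq c\,[Ty,Ty]_{\mathcal{K}}\quad\text{for every } y\in\mathcal{C}_V.$$
   Context: $(\mathcal{H},\langle\cdot,\cdot\rangle)$ is a complex separable Hilbert space, $(\mathcal{K},[\cdot,\cdot]_{\mathcal{K}})$ and $(\mathcal{E},[\cdot,\cdot]_{\mathcal{E}})$ are complex Krein spaces (boundedness of operators refers to the norm of any associated Hilbert space). $T:\mathcal{H}\to\mathcal{K}$ is a bounded linear operator with closed range and $V:\mathcal{H}\to\mathcal{E}$ is a bounded linear surjective operator such that $V^\#V$ is indefinite, i.e. neither positive nor negative semidefinite; here $V^\#:\mathcal{E}\to\mathcal{H}$ is the adjoint determined by $[Vx,z]_{\mathcal{E}}=\langle x,V^\#z\rangle$ for all $x\in\mathcal{H}$, $z\in\mathcal{E}$. $\mathcal{C}_V=\{y\in\mathcal{H}: [Vy,Vy]_{\mathcal{E}}=0\}$.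
   Formalization: In (ii) the constant is required to satisfy c > 0 instead of c ≥ 0: with c = 0 the claim fails, e.g. for 𝒦 = (ℋ, −⟨·,·⟩), T the identity, x₀ = w₀ = 0, where (ii) holds but the infimum is −∞. *)

(* Defs.v *)
From HB Require Import structures.
From mathcomp Require Import all_boot all_order all_algebra.
From mathcomp Require Import sesquilinear.
From mathcomp Require Import all_classical all_reals all_analysis.
From mathcomp Require Import complex.

Set Implicit Arguments.
Unset Strict Implicit.
Unset Printing Implicit Defensive.

Import Order.TTheory GRing.Theory Num.Theory.
Import numFieldNormedType.Exports.

Local Open Scope classical_set_scope.
Local Open Scope ring_scope.
Local Open Scope complex_scope.

(* Sesquilinear forms are linear in the first argument and conjugate-linear in
   the second.  The order of R[i] is the partial one, in which x <= y entails
   that y - x is real; the norm of a normedModType R[i] is R[i]-valued. *)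
Notation hermitian_form U := {hermitian U for false & Num.conj}.
Notation inner_product U := {dot U for Num.conj}.

Section Spaces.
Context {R : realType}.

Definition is_hilbert (H : completeNormedModType R[i])
    (ip : inner_product H) : Prop :=
  forall x : H, `|x| ^+ 2 = ip x x.

Definition separable (S : topologicalType) : Prop :=
  exists2 D : set S, countable D & dense D.

Definition is_subspace (U : lmodType R[i]) (M : set U) : Prop :=
  M 0 /\ forall (a : R[i]) (x y : U), M x -> M y -> M (a *: x + y).

(* K = Kp + Km is orthogonal for [.,.], and the ambient norm is the Hilbert norm
   that it induces.  The norm identity makes [.,.] positive definite on Kp and
   negative definite on Km, hence the sum direct; completeness of K amounts to
   that of (Kp, [.,.]) and (Km, -[.,.]). *)
Definition fundamental_decomposition (K : completeNormedModType R[i])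
    (f : hermitian_form K) (Kp Km : set K) : Prop :=
  [/\ is_subspace Kp, is_subspace Km,
      forall x, exists u v, [/\ Kp u, Km v & x = u + v],
      forall u v, Kp u -> Km v -> f u v = 0 &
      forall u v, Kp u -> Km v -> `|u + v| ^+ 2 = f u u - f v v].

(* The norm of K is one of the associated Hilbert norms; these are pairwise
   equivalent, so boundedness and closedness do not depend on which one. *)
Definition is_krein (K : completeNormedModType R[i])
    (f : hermitian_form K) : Prop :=
  exists Kp Km, fundamental_decomposition f Kp Km.

Definition bounded_operator (U W : normedModType R[i])
    (A : {linear U -> W}) : Prop :=
  exists M : R, forall x, `|A x| <= M%:C * `|x|.

Definition is_adjoint (H E : lmodType R[i]) (ip : inner_product H)
    (f : hermitian_form E) (V : H -> E) (Vs : E -> H) : Prop :=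
  forall x z, f (V x) z = ip x (Vs z).

Definition positive_semidefinite (H : lmodType R[i]) (ip : inner_product H)
    (A : H -> H) : Prop :=
  forall x, 0 <= ip (A x) x.

Definition negative_semidefinite (H : lmodType R[i]) (ip : inner_product H)
    (A : H -> H) : Prop :=
  forall x, ip (A x) x <= 0.

Definition indefinite (H : lmodType R[i]) (ip : inner_product H)
    (A : H -> H) : Prop :=
  ~ positive_semidefinite ip A /\ ~ negative_semidefinite ip A.

Definition isotropic_vectors (H E : lmodType R[i]) (f : hermitian_form E)
    (V : H -> E) : set H :=
  [set y | f (V y) (V y) = 0].

End Spaces.

(* Main.v *)
(** The cone [C_V] is stable under all complex scalars, so along each line
    spanned by [y] in [C_V] the functional is a real quadratic polynomial,
    bounded below exactly when its discriminant is controlled. Scaling [y] by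
    [[u, y]] turns the cross term [Re [u, y]] into [|[u, y]|^2], so no phase
    has to be chosen. *)

Require Import Defs.
From mathcomp Require Import all_boot all_order all_algebra.
From mathcomp Require Import sesquilinear.
From mathcomp Require Import all_classical all_reals all_analysis.
From mathcomp Require Import complex.
From mathcomp Require Import ring lra.
Import Order.TTheory GRing.Theory Num.Theory.
Import numFieldNormedType.Exports.
Local Open Scope classical_set_scope.
Local Open Scope ring_scope.
Local Open Scope complex_scope.

(** The factor 2 on the linear term makes the discriminant [4 * (b ^+ 2 - a * m)]. The degenerate
    case [a = 0] is covered. *)
Lemma half_discriminant_le0 (R : rcfType) (a b m : R) :
  (forall s, 0 <= a * s ^+ 2 + 2 * b * s + m) -> b ^+ 2 <= a * m.
Proof.
move=> h; pose p : {poly R} := Poly [:: m; 2 * b; a].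
have size_p : (size p <= 3)%N by rewrite (leq_trans (size_Poly _)).
have p_ge0 x : 0 <= p.[x].
  rewrite horner_Poly /= mul0r add0r.
  have -> : (a * x + 2 * b) * x + m = a * x ^+ 2 + 2 * b * x + m by ring.
  exact: h.
have := deg_le2_poly_ge0 size_p p_ge0; rewrite !coef_Poly /=.
by move=> disc; lra.
Qed.

Section HermitianForm.
Variables (R : realType) (U : lmodType R[i]) (f : hermitian_form U).

Lemma Im_herm_diag x : complex.Im (f x x) = 0.
Proof.
have := hermC f x x; rewrite expr0 mul1r.
case: (f x x) => a b [] /= /eqP.
by rewrite -addr_eq0 -mulr2n mulrn_eq0 /= => /eqP.
Qed.

Lemma Re_hermD x y :
  complex.Re (f (x + y) (x + y)) =
  complex.Re (f x x) + complex.Re (f y y) + 2 * complex.Re (f x y).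
Proof.
rewrite hnormD /= expr0 mul1r.
by case: (f x x) => a b; case: (f y y) => c d; case: (f x y) => p q /=; ring.
Qed.

Lemma Re_hermZ (a : R[i]) x :
  complex.Re (f (a *: x) (a *: x)) =
  (complex.Re a ^+ 2 + complex.Im a ^+ 2) * complex.Re (f x x).
Proof.
rewrite linearZl_LR linearZr_LR /=.
have := Im_herm_diag x.
by case: (f x x) => p q /= ->; case: a => a b /=; ring.
Qed.

Lemma Re_hermZr (a : R[i]) x y :
  complex.Re (f x (a *: y)) =
  complex.Re a * complex.Re (f x y) + complex.Im a * complex.Im (f x y).
Proof.
rewrite linearZr_LR /=.
by case: (f x y) => p q; case: a => a b /=; ring.
Qed.

(** Diagonal values of [f] are real, so the partial order of [R[i]] reduces here to the order of the
    real parts. *)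
Lemma sqr_norm_herm_le (c : R) x y :
  (`|f x y| ^+ 2 <= c%:C * f y y) =
  (complex.Re (f x y) ^+ 2 + complex.Im (f x y) ^+ 2
     <= c * complex.Re (f y y)).
Proof.
have := Im_herm_diag y; rewrite -add_Re2_Im2.
case: (f y y) => p q /= ->.
by rewrite lecE /= !mulr0 mul0r addr0 subr0 eqxx.
Qed.

(** Strict positivity of [c] matters: it makes the estimate force [0 <= f y y] on [A], whereas
    [c = 0] would only give [f u y = 0] and leave the sign of [f y y] free. *)
Lemma herm_cone_bounded_below (A : set U) (u : U) :
  (forall (a : R[i]) y, A y -> A (a *: y)) ->
  (exists m : R, forall y, A y -> m <= complex.Re (f (u + y) (u + y))) <->
  (exists2 c : R, 0 < c &
     forall y, A y -> `|f u y| ^+ 2 <= c%:C * f y y).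
Proof.
move=> Ascale; split=> [[m m_le] | [c c_gt0 c_le]].
(* [d] dominates the constant term [Re (f u u) - m] of the quadratic; the added 1 makes it
   positive. *)
- pose d := `|complex.Re (f u u) - m| + 1.
  exists d => [|y Ay]; first by rewrite ltr_wpDl.
  have line (a : R[i]) :
      0 <= (complex.Re a ^+ 2 + complex.Im a ^+ 2) * complex.Re (f y y)
           + 2 * (complex.Re a * complex.Re (f u y)
                  + complex.Im a * complex.Im (f u y)) + d.
    have := m_le _ (Ascale a y Ay); rewrite Re_hermD Re_hermZ Re_hermZr /d.
    by have := ler_norm (complex.Re (f u u) - m); lra.
  rewrite sqr_norm_herm_le.
  move: line; case: (f u y) => p q /=; set Q := complex.Re (f y y) => line.
  (* If [f u y = 0], scaling by it would collapse the line to a point; real scalars are used instead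
     and give [0 <= Q * d]. *)
  have [n0|n_neq0] := eqVneq (p ^+ 2 + q ^+ 2) 0.
    have -> : p ^+ 2 + q ^+ 2 = p ^+ 2.
      by apply/eqP; have := sqr_ge0 p; have := sqr_ge0 q; lra.
    rewrite mulrC; apply: half_discriminant_le0 => s.
    by have := line s%:C => /=; lra.
  have n_gt0 : 0 < p ^+ 2 + q ^+ 2 by rewrite lt0r n_neq0 addr_ge0 ?sqr_ge0.
  (* With n = [p ^+ 2 + q ^+ 2], the scalars [s * f u y] give the quadratic n Q s^2 + 2 n s + d; one
     factor n of the discriminant bound then cancels. *)
  have disc : (p ^+ 2 + q ^+ 2) ^+ 2 <= (p ^+ 2 + q ^+ 2) * Q * d.
    apply: half_discriminant_le0 => s.
    by have := line ((s * p) +i* (s * q)) => /=; lra.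
  by rewrite -(ler_pM2l n_gt0) -expr2 (le_trans disc)// -mulrA [Q * d]mulrC.
- exists (complex.Re (f u u) - c) => y Ay.
  have := c_le y Ay; rewrite sqr_norm_herm_le Re_hermD.
  move: (complex.Re (f u y)) (complex.Im (f u y)) => p q.
  set Q := complex.Re (f y y) => hQ.
  (* Complete the square: the right side is (c Q - p^2 - q^2) + (p + c)^2 + q^2. Dividing by [c]
     gives Q + 2 p >= -c. *)
  have : 0 <= c * (Q + 2 * p + c).
    by have := sqr_ge0 (p + c); have := sqr_ge0 q; lra.
  by rewrite pmulr_rge0// => ?; lra.
Qed.

End HermitianForm.

Lemma ereal_inf_gtNy (R : realType) (I : Type) (D : set I) (g : I -> R) :
  (-oo < ereal_inf [set (g i)%:E | i in D])%E <->
  (exists m : R, forall i, D i -> m <= g i).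
Proof.
split=> [|[m m_le]].
- have lb i : D i -> (ereal_inf [set (g i)%:E | i in D] <= (g i)%:E)%E.
    by move=> Di; apply: ereal_inf_lbound; exists i.
  (* A real infimum is itself the bound; an infimum of [+oo] means that [D] is empty, so the bound 0
     is arbitrary. *)
  case: (ereal_inf _) lb => [m lb _ | lb _ | //].
    by exists m => i /lb; rewrite lee_fin.
  by exists 0 => i /lb.
- apply: (@lt_le_trans _ _ m%:E); first exact: ltNyr.
  by apply: le_ereal_inf_tmp => _ [i Di <-]; rewrite lee_fin m_le.
Qed.

Theorem proposition3p1 (R : realType)
    (H K E : completeNormedModType R[i])
    (ip : inner_product H) (fK : hermitian_form K) (fE : hermitian_form E)
    (hH : is_hilbert ip) (sepH : separable H)
    (hK : is_krein fK) (hE : is_krein fE)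
    (T : {linear H -> K}) (T_bounded : bounded_operator T)
    (T_closed : closed (range T))
    (V : {linear H -> E}) (V_bounded : bounded_operator V)
    (V_surj : range V = setT)
    (Vs : E -> H) (Vs_adj : is_adjoint ip fE V Vs)
    (VsV_indef : indefinite ip (Vs \o V))
    (x0 : H) (w0 : K) :
  (-oo < ereal_inf
     [set (complex.Re (fK (T (x0 + y) - w0) (T (x0 + y) - w0)))%:E
       | y in isotropic_vectors fE V])%E
  <->
  (exists2 c : R, 0 < c &
     forall y, isotropic_vectors fE V y ->
       `|fK (T x0 - w0) (T y)| ^+ 2 <= c%:C * fK (T y) (T y)).
Proof.
rewrite ereal_inf_gtNy.
(* The problem moves to [K]: the image of the isotropic cone under [T] is again stable under complex
   scalars, and the base point becomes [T x0 - w0]. *)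
pose A : set K := [set T y | y in isotropic_vectors fE V].
have Ascale (a : R[i]) z : A z -> A (a *: z).
  move=> [y Cy <-]; exists (a *: y); last by rewrite linearZ.
  rewrite /isotropic_vectors /= linearZ linearZl_LR linearZr_LR /=.
  by rewrite [fE _ _]Cy !mulr0.
have TD y : T (x0 + y) - w0 = (T x0 - w0) + T y by rewrite linearD addrAC.
have [to_c from_c] := herm_cone_bounded_below _ _ fK _ (T x0 - w0) Ascale.
split=> [[m m_le] | [c c_gt0 c_le]].
- have [|c c_gt0 c_le] := to_c.
    by exists m => _ [y Cy <-]; rewrite -TD; exact: m_le.
  by exists c => // y Cy; apply: c_le; exists y.
- have [|m m_le] := from_c.
    by exists c => // _ [y Cy <-]; exact: c_le.
  by exists m => y Cy; rewrite TD; apply: m_le; exists y.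
Qed.
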